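(* Let $G$ be a connected graph with minimum degree $\delta(G) \geq 2$ and maximum degree $\Delta(G)$, and let $\overleftrightarrow{G}$ be the associated symmetric digraph. Then $$M'_D(\overleftrightarrow{G}) \leq \left\lceil \sqrt[4]{\Delta(G)} \right\rceil + 4.$$
   Context: Graphs are finite, simple and undirected. The symmetric digraph $\overleftrightarrow{G}$ is obtained from $G$ by replacing each edge $uv$ by the pair of opposite arcs $\overrightarrow{uv}$ and $\overrightarrow{vu}$. An arc coloring $c : A(D) \to [k]$ of a digraph $D$ is a majority arc coloring if for every vertex $u$ and every color $\alpha$, at most half of the arcs entering $u$ have color $\alpha$ and at most half of the arcs leaving $u$ have color $\alpha$. It is distinguishing if the only automorphism $\varphi$ of $D$ (a permutation of vertices preserving arcs and their directions) with $c(\overrightarrow{\varphi(u)\varphi(v)}) = c(\overrightarrow{uv})$ for all arcs $\overrightarrow{uv}$ is the identity. $M'_D(D)$ is the least number of colors in an arc coloring of $D$ that is both a majority arc coloring and distinguishing. *)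

(* Defs.v *)
From HB Require Import structures.
From mathcomp Require Import all_boot all_order all_fingroup all_algebra all_field.
Set Implicit Arguments.
Unset Strict Implicit.
Unset Printing Implicit Defensive.

Import Order.TTheory GRing.Theory Num.Theory.

Record sgraph := SGraph {
  vertex :> finType;
  adj : rel vertex;
  adj_sym : symmetric adj;
  adj_irrefl : irreflexive adj
}.

Record digraph := Digraph {
  dvertex :> finType;
  is_arc : rel dvertex
}.

Section SimpleGraphs.
Variable G : sgraph.

Definition degree (v : G) : nat := #|[set w | adj v w]|.

(* A degree is less than #|G|, so the default value #|G| does not affect the
   minimum when G is nonempty. *)
Definition min_degree : nat := \big[minn/#|G|]_(v : G) degree v.

Definition max_degree : nat := \max_(v : G) degree v.

Definition connected_graph : Prop :=
  0 < #|G| /\ forall u v : G, connect (@adj G) u v.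

(* As adj is symmetric, each edge uv contributes both arcs (u, v) and (v, u). *)
Definition sym_digraph : digraph := @Digraph G (@adj G).

End SimpleGraphs.

Section ArcColorings.
Variable D : digraph.

(* The arc from u to v is the pair (u, v). *)
Definition arc : finType := {p : D * D | is_arc p.1 p.2}.

Definition tail (a : arc) : D := (val a).1.
Definition head (a : arc) : D := (val a).2.

Definition majority (k : nat) (c : arc -> 'I_k) : Prop :=
  forall (u : D) (alpha : 'I_k),
    2 * #|[set a : arc | (head a == u) && (c a == alpha)]|
      <= #|[set a : arc | head a == u]|
    /\
    2 * #|[set a : arc | (tail a == u) && (c a == alpha)]|
      <= #|[set a : arc | tail a == u]|.

Definition automorphism (phi : {perm D}) : Prop :=
  forall u v : D, is_arc (phi u) (phi v) = is_arc u v.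

(* b is the image of the arc a under phi. *)
Definition preserves (phi : {perm D}) (k : nat) (c : arc -> 'I_k) : Prop :=
  forall a b : arc, tail b = phi (tail a) -> head b = phi (head a) -> c b = c a.

Definition distinguishing (k : nat) (c : arc -> 'I_k) : Prop :=
  forall phi : {perm D}, automorphism phi -> preserves phi c -> phi = 1%g.

Definition majority_distinguishable (k : nat) : Prop :=
  exists c : arc -> 'I_k, majority c /\ distinguishing c.

(* M'_D(D) = m.  This is a relation because some digraphs have no majority arc
   coloring, for instance those with a vertex of in-degree 1. *)
Definition is_majority_dist_index (m : nat) : Prop :=
  majority_distinguishable m /\
  forall k : nat, majority_distinguishable k -> m <= k.

End ArcColorings.

(* 4.-root of a nonnegative element of algC is its nonnegative real root. *)
Definition ceil_fourth_root (n : nat) : int :=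
  Num.ceil (4.-root (n%:R : algC))%R.

(* Main.v *)
(* Put r = ceil(Delta^(1/4)), so that r >= 2 and Delta <= r^4, and use r + 4
   colors.  Split the neighborhood of every vertex u into deg(u)/2 groups of
   two or three vertices; if the arcs joining u to one group always get distinct
   colors in each direction, the coloring is a majority coloring.  Color the
   edges (both arcs at once) greedily: the group rule forbids at most 4 colors
   per arc, and fewer for the first edges reaching a vertex.

   The order of the vertices is a breadth-first search which, among the
   neighbors of the current vertex, prefers those already having two placed
   neighbors.  A vertex with two earlier neighbors is recognized by the four
   colors on the edges to the first two of them, since r^2 * r^2 >= Delta.  A
   vertex with a single earlier neighbor v (a "starter") is recognized by the
   pair of colors on its edge to v together with its palette, the multiset of
   color pairs around it; each pair occurs at most r^2 times among the children
   of v, so its palette has to avoid fewer than r^2 others.  Finally all palettes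
   differ from that of the root, which therefore is fixed, and the other
   vertices are fixed one after the other. *)
Require Import Defs.
From HB Require Import structures.
From mathcomp Require Import all_boot all_order all_fingroup all_algebra all_field.
From mathcomp Require Import zify.
From Stdlib Require Import Classical_Prop.

Set Implicit Arguments.
Unset Strict Implicit.
Unset Printing Implicit Defensive.

(** * Search order *)

Section SearchOrder.
Variables (G : sgraph) (v0 : G).
Hypothesis G_conn : forall u v : G, connect (@adj G) u v.

(* [v] is the first vertex of [s] with a neighbor outside [s]; when [y] has no
   other neighbor in [s], neither has any other candidate. *)
Definition next_ok (s : seq G) (y : G) :=
  y \notin s /\ exists v : G,
  [/\ v \in s, adj v y,
      forall u w, u \in s -> index u s < index v s -> w \notin s -> ~~ adj u w
    & (exists z, [/\ z \in s, z != v & adj z y]) \/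
      (forall x z, x \notin s -> adj v x -> z \in s -> adj z x -> z = v)].

(** By connectivity some placed vertex has an unplaced neighbor; [v] is the first such. An unplaced
    neighbor of [v] with a second placed neighbor is preferred, and any other is taken only in its
    absence. *)
Lemma next_exists (s : seq G) : v0 \in s -> uniq s -> size s < #|G| ->
  exists y, next_ok s y.
Proof.
move=> s0 us ss.
pose out v := [exists w, (w \notin s) && adj v w].
have hs : has out s.
  apply/negPn/negP => /hasPn no.
  have cl : closed (@adj G) (mem s).
    apply: intro_closed => [x y|x y xy xs]; first exact/sym_connect_sym/adj_sym.
    apply/negPn/negP => ys; move/negP: (no _ xs); apply.
    by apply/existsP; exists y; rewrite ys xy.
  have : #|G| <= size s; last by lia.
  rewrite -(card_uniqP us) -cardsT subset_leq_card //; apply/subsetP => x _.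
  by have e : (v0 \in s) = (x \in s) := closed_connect cl (G_conn v0 x); rewrite -e.
pose v := nth v0 s (find out s).
have fs : find out s < size s by rewrite -has_find.
have vs : v \in s by rewrite mem_nth.
have iv : index v s = find out s by rewrite index_uniq.
have early u w : u \in s -> index u s < index v s -> w \notin s -> ~~ adj u w.
  rewrite iv => us' lt ws; have := before_find v0 lt; rewrite nth_index // => /negbT.
  by rewrite negb_exists => /forallP/(_ w); rewrite ws.
case: (boolP [exists y, [&& y \notin s, adj v y &
          [exists z, [&& z \in s, z != v & adj z y]]]]).
  case/existsP => y /and3P[ys vy /existsP[z /and3P[zs zv zy]]].
  exists y; split=> //; exists v; split=> //; left; by exists z.
rewrite negb_exists => /forallP no.
have /existsP[y /andP[ys vy]] : out v by exact: nth_find.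
exists y; split=> //; exists v; split=> //; right=> x z xs vx zs zx.
have := no x; rewrite xs vx /= negb_exists => /forallP/(_ z).
by rewrite zs zx andbT /= negbK => /eqP.
Qed.

Lemma search_seq : exists s : seq G,
  [/\ uniq s, forall x, x \in s, nth v0 s 0 = v0
    & forall i, 0 < i < size s -> next_ok (take i s) (nth v0 s i)].
Proof.
have G0 : 0 < #|G| by apply/card_gt0P; exists v0.
suff H m : m < #|G| -> exists s : seq G, [/\ uniq s, size s = m.+1, nth v0 s 0 = v0
    & forall i, 0 < i < size s -> next_ok (take i s) (nth v0 s i)].
  have [|s [us ss s0 H1]] := H #|G|.-1; first by lia.
  exists s; split=> // x.
  have [||_ ->] := @uniq_min_size _ s (enum G) us; last by rewrite mem_enum.
    by move=> z _; rewrite mem_enum.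
  by rewrite -cardE ss prednK.
elim: m => [|m IH] lt.
  by exists [:: v0]; split=> //; case=> [|[|i]].
have [|s [us ss s0 Hs]] := IH; first by lia.
have v0s : v0 \in s by rewrite -s0 mem_nth ?ss.
have [|y yok] := next_exists v0s us; first by rewrite ss.
exists (rcons s y); split.
- by rewrite rcons_uniq us andbT; case: yok.
- by rewrite size_rcons ss.
- by rewrite nth_rcons ss.
move=> i; rewrite size_rcons => /andP[i0 ile].
rewrite nth_rcons -cats1 take_cat.
move: ile; rewrite ltnS leq_eqVlt => /predU1P[->|il]; last first.
  by rewrite il; apply: Hs; rewrite i0.
by rewrite ltnn eqxx subnn cats0.
Qed.

Definition starter (rk : G -> nat) (par : G -> G) (y : G) :=
  (y != v0) && [forall z, adj z y ==> (rk z < rk y) ==> (z == par y)].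

Lemma nonstarter_neighbor (rk : G -> nat) (par : G -> G) y :
  y != v0 -> ~~ starter rk par y ->
  exists w, [&& adj w y, rk w < rk y & w != par y].
Proof.
move=> y0; rewrite /starter y0 /= negb_forall => /existsP[w].
by rewrite !negb_imply => h; exists w.
Qed.

(** [rk] is the position in the search and [par y] the vertex from which [y] was reached. The last
    clause records the tie-break: when a starter [t] was placed, no unplaced neighbor of [par t] had
    a second placed neighbor. *)
Lemma search_order : exists (rk : G -> nat) (par : G -> G),
  [/\ injective rk,
      (forall y, y != v0 -> adj (par y) y /\ rk (par y) < rk y),
      (forall y z, y != v0 -> adj z y -> rk (par y) <= rk z),
      (forall y z, y != v0 -> z != v0 -> rk y <= rk z -> rk (par y) <= rk (par z)) &
      forall t x z, starter rk par t -> x != v0 -> par x = par t ->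
        rk t <= rk x -> adj z x -> rk z < rk t -> z = par t].
Proof.
have [s [us sG s0 Hs]] := search_seq.
pose rk x := index x s.
have rk_inj : injective rk.
  by move=> x y e; rewrite -(nth_index v0 (sG x)) -(nth_index v0 (sG y)) [index x s]e.
have rklt x : rk x < size s by rewrite index_mem.
have nthrk x : nth v0 s (rk x) = x by rewrite nth_index.
have rk_gt0 y : y != v0 -> 0 < rk y.
  move=> y0; rewrite lt0n; apply: contra y0 => /eqP r0.
  by rewrite -(nthrk y) r0 s0.
have intake i x : (x \in take i s) = (rk x < i) by rewrite in_take.
pose good y v := [&& adj v y, rk v < rk y &
  [forall u, forall w, (rk u < rk v) ==> (rk y <= rk w) ==> ~~ adj u w] &&
  ([exists z, [&& rk z < rk y, z != v & adj z y]] ||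
   [forall x, forall z,
      (rk y <= rk x) ==> adj v x ==> (rk z < rk y) ==> adj z x ==> (z == v)])].
have goodP y : y != v0 -> exists v, good y v.
  move=> y0; have [|yt [v]] := Hs (rk y); first by rewrite rk_gt0 ?rklt.
  rewrite nthrk intake => -[vs vy e1 e2]; exists v; apply/and3P; split=> //.
  apply/andP; split.
    apply/forallP => u; apply/forallP => w; apply/implyP => uv; apply/implyP => yw.
    apply: e1; rewrite ?intake -?leqNgt //; first exact: ltn_trans vs.
    have ix z : rk z < rk y -> index z (take (rk y) s) = rk z.
      move=> zy; rewrite -[X in _ = X]/(index z s) -{2}(cat_take_drop (rk y) s).
      by rewrite index_cat intake zy.
    by rewrite !ix //; exact: ltn_trans vs.
  case: e2 => [[z [zs zv zy]]|e2]; apply/orP; [left|right].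
    by apply/existsP; exists z; rewrite -intake zs zv zy.
  apply/forallP => x; apply/forallP => z; do 4![apply/implyP=> ?].
  by apply/eqP; apply: (e2 x); rewrite ?intake -?leqNgt.
(* The default is taken only at the root. *)
pose par y := odflt y [pick v | good y v].
have parP y : y != v0 -> good y (par y).
  move=> y0; rewrite /par; case: pickP => //= no.
  by case: (goodP y y0) => v; rewrite no.
have par_min y z : y != v0 -> adj z y -> rk (par y) <= rk z.
  move=> y0 zy; have /and3P[_ _ /andP[/forallP/(_ z)/forallP/(_ y) + _]] := parP y y0.
  by rewrite leqnn zy /= implybF -leqNgt.
exists rk, par; split=> //.
- by move=> y /parP /and3P[].
- move=> y z y0 z0 yz.
  have /and3P[_ _ /andP[/forallP/(_ (par z))/forallP/(_ z) + _]] := parP y y0.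
  have /and3P[-> _ _] := parP z z0.
  by rewrite yz /= implybF -leqNgt.
move=> t x z /andP[t0 /forallP ts] x0 pxt tx zx zt.
have /and3P[pt ptl /andP[_ /orP[]]] := parP t t0;
  [move=> /existsP[w /and3P[wt wp wt']]|move=> /forallP/(_ x)/forallP/(_ z)].
  by have := ts w; rewrite wt wt' (negPf wp).
have /and3P[px _ _] := parP x x0; rewrite pxt in px.
by rewrite tx px zt zx /= => /eqP.
Qed.

End SearchOrder.

(** * Groups and multisets *)

Lemma small_groups (T : finType) (N : {set T}) : exists g : T -> nat,
  (1 < #|N| -> forall z, z \in N -> g z < #|N|./2) /\
  forall y, y \in N -> #|[set z in N | (g z == g y) && (z != y)]| <= 2.
Proof.
(* Consecutive pairs of an enumeration, an odd last element joining the last pair. *)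
pose g z := minn (index z (enum N))./2 (#|N|./2).-1.
exists g; split=> [N2 z zN|y yN].
  by rewrite /g; lia.
pose S := [set z in N | g z == g y].
have -> : [set z in N | (g z == g y) && (z != y)] = S :\ y.
  by apply/setP=> z; rewrite !inE andbA andbC.
have S3 : #|S| <= 3.
  pose s := [seq nth y (enum N) i | i <- iota (g y).*2 3].
  apply: leq_trans (card_size s); apply: subset_leq_card; apply/subsetP => z.
  rewrite inE => /andP[zN /eqP gzy]; apply/mapP; exists (index z (enum N)).
    rewrite mem_iota -gzy; have : index z (enum N) < #|N|.
      by rewrite cardE index_mem mem_enum.
    by rewrite /g; lia.
  by rewrite nth_index ?mem_enum.
by have := cardsD1 y S; rewrite inE yN eqxx; lia.
Qed.

Lemma card_bigcup_leq (I T : finType) (F : {set I}) (S : I -> {set T}) n :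
  (forall i, i \in F -> #|S i| <= n) -> #|\bigcup_(i in F) S i| <= #|F| * n.
Proof.
move=> H; rewrite -sum_nat_const.
elim/big_rec2: _ => [|i m A iF le]; first by rewrite cards0.
by apply: leq_trans (leq_card_setU _ _) _; rewrite leq_add ?H.
Qed.

Lemma card_frequent (T P : finType) (Q : {set T}) (f : T -> P) n :
  #|[set p | n <= #|[set z in Q | f z == p]|]| * n <= #|Q|.
Proof.
rewrite -sum_nat_const -[leqRHS]sum1_card.
rewrite (partition_big f xpredT) //=; set S := [set p | _].
rewrite [leqRHS](bigID (fun p => p \in S)) /=.
apply: leq_trans (leq_addr _ _); apply: leq_sum => p; rewrite inE => le.
apply: leq_trans le _; rewrite -sum1_card; apply: eq_leq; apply: eq_bigl => z.
by rewrite inE.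
Qed.

Section Multisets.
Variable P : finType.
Implicit Types (m : {ffun P -> nat}) (p q : P).

Definition mset_add m p : {ffun P -> nat} := [ffun q => m q + (q == p)].

Lemma mset_add_inj m : injective (mset_add m).
Proof.
move=> p q /ffunP/(_ p); rewrite !ffunE eqxx => /addnI.
by case: eqP.
Qed.

(** Cancelling [m] leaves two-element multisets, which determine their elements up to order; hence
    the factor 2 in [card_hits2]. *)
Lemma mset_add2_inj m p q p' q' :
  mset_add (mset_add m p) q = mset_add (mset_add m p') q' ->
  (p, q) = (p', q') \/ (p, q) = (q', p').
Proof.
move=> e; have {}e x : (x == p) + (x == q) = (x == p') + (x == q').
  by move/ffunP/(_ x): e; rewrite !ffunE -!addnA => /addnI.
case: (p =P p') => [pp|/eqP np].
  by have := e q; rewrite -pp eqxx => /addnI; case: (q =P q') => [->|//]; left.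
have := e p; rewrite eqxx (negPf np).
case: (p =P q') => [-> _|//]; have := e p'; rewrite eqxx eq_sym (negPf np).
by case: (p' =P q) => [->|//]; right.
Qed.

Variables (T : finType) (F : {set T}) (f : T -> {ffun P -> nat}).

Definition hits m := [exists x in F, m == f x].

Lemma card_hits1 m : #|[set p | hits (mset_add m p)]| <= #|F|.
Proof.
pose S x := [set p | mset_add m p == f x].
rewrite -[leqRHS]muln1; apply: leq_trans (card_bigcup_leq (S := S) _); last first.
  move=> x _; apply/card_le1_eqP => p q; rewrite !inE => /eqP e /eqP e'.
  by apply: (@mset_add_inj m); rewrite e e'.
apply: subset_leq_card; apply/subsetP => p; rewrite inE => /exists_inP[x xF e].
by apply/bigcupP; exists x => //; rewrite inE.
Qed.

Lemma card_hits2 m :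
  #|[set pq | hits (mset_add (mset_add m pq.1) pq.2)]| <= 2 * #|F|.
Proof.
pose S x := [set pq | mset_add (mset_add m pq.1) pq.2 == f x].
rewrite mulnC; apply: leq_trans (card_bigcup_leq (S := S) _); last first.
  move=> x _; have [->|[[p q]]] := set_0Vmem (S x); first by rewrite cards0.
  rewrite inE => /eqP e; apply: (@leq_trans #|[set (p, q); (q, p)]|).
    apply: subset_leq_card; apply/subsetP => -[p' q']; rewrite !inE /= -e.
    by move=> /eqP/mset_add2_inj[->|->]; rewrite eqxx ?orbT.
  by rewrite cards2; case: eqP.
apply: subset_leq_card; apply/subsetP => p; rewrite inE => /exists_inP[x xF e].
by apply/bigcupP; exists x => //; rewrite inE.
Qed.

(** Double counting of the ordered completions [(p, q)], of which there are at most [2 * #|F|]. *)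
Lemma card_many_hits m n :
  #|[set p | n <= #|[set q | hits (mset_add (mset_add m p) q)]|]| * n <= 2 * #|F|.
Proof.
set S := [set p | _]; apply: leq_trans (card_hits2 m).
rewrite -sum_nat_const -sum1_card.
rewrite (eq_bigl (fun pq => hits (mset_add (mset_add m pq.1) pq.2))); last first.
  by move=> pq; rewrite inE.
rewrite -(pair_big_dep xpredT (fun p q => hits (mset_add (mset_add m p) q))
           (fun _ _ => 1)) /=.
rewrite [leqRHS](bigID (fun p => p \in S)) /=; apply: leq_trans (leq_addr _ _).
apply: leq_sum => p; rewrite inE => le; apply: leq_trans le _.
by rewrite -sum1_card; apply: eq_leq; apply: eq_bigl => q; rewrite inE.
Qed.

End Multisets.

(** * Greedy coloring of the edges *)

Section Greedy.
Variables (G : sgraph) (v0 : G) (rk : G -> nat) (par : G -> G).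
Variables (g : G -> G -> nat) (r : nat).

Hypothesis rk_inj : injective rk.
Hypothesis parP : forall y, y != v0 -> adj (par y) y /\ rk (par y) < rk y.
Hypothesis par_min : forall y z, y != v0 -> adj z y -> rk (par y) <= rk z.
Hypothesis g_fibre : forall u y,
  adj u y -> #|[set z | adj u z && ((g u z == g u y) && (z != y))]| <= 2.
Hypothesis r_gt1 : 1 < r.
Hypothesis degree_gt1 : forall u : G, 1 < degree u.
Hypothesis degree_le : forall u : G, degree u <= r ^ 4.

Definition color := 'I_(r + 4).
Implicit Types (c : G -> G -> color) (x y z u w : G) (p q : color * color).

Definition pr c x y := (c x y, c y x).
Definition swap p : color * color := (p.2, p.1).

Definition child x y := (y != v0) && (par y == x).
(** As [par y] is the first neighbor of [y], this [x] is the second one in the order [rk]. *)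
Definition second x y := [&& y != v0, adj x y, rk x < rk y, x != par y &
  [forall z, adj z y ==> (z != par y) ==> (rk x <= rk z)]].
Definition final x y := [forall z, adj x z ==> (rk z <= rk y)].
Notation starter := (starter v0 rk par).

(* The palette of [x] restricted to its neighbors before [y]. *)
Definition bas c x y : {ffun color * color -> nat} :=
  [ffun p => #|[set z | [&& adj x z, rk z < rk y & pr c x z == p]]|].
Definition pal c x : {ffun color * color -> nat} :=
  [ffun p => #|[set z | adj x z && (pr c x z == p)]|].

(* [peers x y] are the members of the group of [y] at [x] whose edge to [x] is
   colored before [xy], whichever of [x] and [y] comes first. *)
Definition peers x y :=
  [set z | [&& adj x z, g x z == g x y, z != y & rk z < rk y]].
Definition free_out c x y :=
  ~: ([set c x z | z in peers x y] :|: [set c z y | z in peers y x]).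
Definition free_in c x y :=
  ~: ([set c z x | z in peers x y] :|: [set c y z | z in peers y x]).

(* The pairs forbidden on the edge [xy], for [x] before [y].  [ban_full] lets a
   pair occur only [r ^ 2] times among the children of [x]; [ban_start] separates
   [y] from the last starter before it among its siblings; [ban_twin] separates
   vertices with the same first two neighbors; [ban_root] and [ban_last] act when
   the palette of [y], resp. [x], gets completed by [xy]; [ban_penult] keeps most
   choices open for the last edge at [x]. *)
Definition ban_full c x y := [set p | child x y &&
  (r ^ 2 <= #|[set z | [&& child x z, rk z < rk y & pr c x z == p]]|)].
Definition ban_start c x y := [set p | [&& child x y, ~~ starter y &
  [exists t, [&& child x t, starter t, rk t < rk y, pr c x t == p &
    [forall t', child x t' ==> starter t' ==> (rk t < rk t') ==> (rk y <= rk t')]]]]].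
Definition ban_twin c x y := [set p | second x y &&
  [exists z, [&& rk z < rk y, second x z, par z == par y,
    pr c (par y) z == pr c (par y) y & pr c x z == p]]].
Definition ban_root c x y := [set p | [&& x != v0, final y x &
  mset_add (bas c y x) (swap p) == pal c v0]].
(** The vertices before [x] from whose palettes that of [x] has to differ: the root and, for a
    starter, the earlier siblings with the same color pair at the parent. *)
Definition rivals c x :=
  if x == v0 then set0 else
  if starter x then v0 |: [set z | [&& child (par x) z, rk z < rk x &
                                     pr c (par x) z == pr c (par x) x]]
  else [set v0].
Definition ban_last c x y :=
  [set p | final x y && hits (rivals c x) (pal c) (mset_add (bas c x y) p)].
Definition ban_penult c x y := [set p | ~~ final x y &&
  (2 * r - 1 <= #|[set q | hits (rivals c x) (pal c)
                              (mset_add (mset_add (bas c x y) p) q)]|)].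

Definition allowed c x y :=
  setX (free_out c x y) (free_in c x y) :\: (ban_full c x y :|: ban_start c x y
    :|: ban_twin c x y :|: ban_root c x y :|: ban_last c x y :|: ban_penult c x y).

(* For [x] before [y], the edges are colored in lexicographic order: this says
   that [uw] is colored before [xy]. *)
Definition before x y u w := [|| rk u < rk x, rk w < rk x,
  (u == x) && (rk w < rk y) | (w == x) && (rk u < rk y)].

Lemma beforeC x y u w : before x y u w = before x y w u.
Proof. by rewrite /before orbCA; do 2![congr orb]; rewrite orbC. Qed.

Lemma child_adj x y : child x y -> adj x y /\ rk x < rk y.
Proof. by case/andP=> /parP yp /eqP <-. Qed.

Lemma second_adj x y : second x y -> adj x y /\ rk x < rk y.
Proof. by case/and5P. Qed.

(** Passing to the parent lowers the rank and is possible everywhere but at the root. *)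
Lemma root_first u : u != v0 -> rk v0 < rk u.
Proof.
move: {2}(rk u) (leqnn (rk u)) => n; elim: n u => [|n IH] u le u0.
  by have [_] := parP u0; lia.
have [_ lt] := parP u0; case: (eqVneq (par u) v0) => [<- //|p0].
by apply: (leq_ltn_trans _ lt); apply/ltnW/IH => //; lia.
Qed.

(** * Dependence of the allowed pairs on earlier edges only *)

Section Locality.
Variables (c c' : G -> G -> color) (x y : G).
Hypotheses (xy : adj x y) (ltxy : rk x < rk y).
Hypothesis agree : forall u w, adj u w -> before x y u w -> c u w = c' u w.

Lemma pr_agree u w : adj u w -> before x y u w -> pr c u w = pr c' u w.
Proof.
by move=> uw b; rewrite /pr !agree // 1?beforeC // adj_sym.
Qed.

(** Every edge at [u] has its earlier end at or before [u], hence precedes [xy]: the palette of [u]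
    is already complete. *)
Lemma pal_agree u : rk u < rk x -> pal c u = pal c' u.
Proof.
move=> ux; apply/ffunP=> p; rewrite !ffunE; congr #|pred_of_set _|.
by apply/setP=> z; rewrite !inE; apply: andb_id2l => uz; rewrite pr_agree // /before ux.
Qed.

Lemma bas_agree u w : (u = x /\ w = y) \/ (u = y /\ w = x) -> bas c u w = bas c' u w.
Proof.
move=> h; apply/ffunP=> p; rewrite !ffunE; congr #|pred_of_set _|.
apply/setP=> z; rewrite !inE; apply: andb_id2l => uz; apply: andb_id2l => lt.
by rewrite pr_agree // /before; case: h => -[e e']; subst u w; rewrite lt ?eqxx ?orbT.
Qed.

Lemma rivals_agree : rivals c x = rivals c' x.
Proof.
rewrite /rivals; case: ifP => // /negbT x0; case: ifP => // _; congr (_ |: _).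
have [px pxl] := parP x0.
apply/setP=> z; rewrite !inE; apply: andb_id2l => /child_adj[pz pzl].
by apply: andb_id2l => zx; rewrite !pr_agree // /before pxl.
Qed.

Lemma rivals_before u z : z \in rivals c u -> rk z < rk u.
Proof.
rewrite /rivals; case: ifP => [_|/negbT u0]; first by rewrite inE.
have r0 := root_first u0.
case: ifP => _; rewrite !inE; last by move/eqP->.
by case/predU1P=> [->|/and3P[]].
Qed.

Lemma hits_agree m : hits (rivals c x) (pal c) m = hits (rivals c' x) (pal c') m.
Proof.
rewrite /hits -rivals_agree; apply: eq_existsb => z; apply: andb_id2l => zr.
by rewrite pal_agree // rivals_before.
Qed.

(** Each set in [allowed] reads [c] only on edges colored before [xy], so coloring further edges
    never invalidates an earlier choice. *)
Lemma allowed_agree : allowed c x y = allowed c' x y.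
Proof.
have yx : adj y x by rewrite adj_sym.
have px z : z \in peers x y -> c x z = c' x z /\ c z x = c' z x.
  rewrite inE => /and4P[xz _ _ lt].
  by rewrite !agree // 1?adj_sym // /before lt eqxx ?orbT.
have py z : z \in peers y x -> c y z = c' y z /\ c z y = c' z y.
  rewrite inE => /and4P[yz _ _ lt].
  by rewrite !agree // 1?adj_sym // /before lt ?orbT.
have fo : free_out c x y = free_out c' x y.
  by congr (~: (_ :|: _)); apply: eq_in_imset => z; [case/px|case/py].
have fi : free_in c x y = free_in c' x y.
  by congr (~: (_ :|: _)); apply: eq_in_imset => z; [case/px|case/py].
have b1 : ban_full c x y = ban_full c' x y.
  apply/setP=> p; rewrite !inE; apply: andb_id2l => _; congr (_ <= #|pred_of_set _|).
  apply/setP=> z; rewrite !inE; apply: andb_id2l => /child_adj[xz _].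
  by apply: andb_id2l => zy; rewrite pr_agree // /before eqxx zy ?orbT.
have b2 : ban_start c x y = ban_start c' x y.
  apply/setP=> p; rewrite !inE; do 2![apply: andb_id2l => _]; apply: eq_existsb => z.
  apply: andb_id2l => /child_adj[xz _]; apply: andb_id2l => _; apply: andb_id2l => zy.
  by rewrite pr_agree // /before eqxx zy ?orbT.
have b3 : ban_twin c x y = ban_twin c' x y.
  apply/setP=> p; rewrite !inE; apply: andb_id2l => xy2; apply: eq_existsb => z.
  apply: andb_id2l => zy; apply: andb_id2l => xz2; apply: andb_id2l => /eqP pe.
  have /and5P[y0 _ _ xp _] := xy2; have [py1 _] := parP y0.
  have plt : rk (par y) < rk x.
    by rewrite ltn_neqAle par_min // andbT; apply: contra xp => /eqP/rk_inj ->.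
  have [xz _] := second_adj xz2.
  have pz : adj (par y) z by rewrite -pe; case/and5P: xz2 => /parP[].
  by rewrite !pr_agree // /before ?plt ?eqxx ?zy ?orbT.
have b4 : ban_root c x y = ban_root c' x y.
  apply/setP=> p; rewrite !inE; apply: andb_id2l => x0; apply: andb_id2l => _.
  rewrite (bas_agree (or_intror (conj erefl erefl))) pal_agree //.
  exact: root_first.
have b5 : ban_last c x y = ban_last c' x y.
  apply/setP=> p; rewrite !inE; apply: andb_id2l => _.
  by rewrite hits_agree (bas_agree (or_introl (conj erefl erefl))).
have b6 : ban_penult c x y = ban_penult c' x y.
  apply/setP=> p; rewrite !inE; apply: andb_id2l => _; congr (_ <= #|pred_of_set _|).
  apply/setP=> q; rewrite !inE.
  by rewrite hits_agree (bas_agree (or_introl (conj erefl erefl))).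
by rewrite /allowed fo fi b1 b2 b3 b4 b5 b6.
Qed.

End Locality.

(** * Counting the forbidden pairs for one edge *)

Section Step.
Variables (c : G -> G -> color) (x y : G).
Hypotheses (xy : adj x y) (ltxy : rk x < rk y).
Hypothesis ok_before : forall u w, adj u w -> rk u < rk w ->
  rk u < rk x \/ u = x /\ rk w < rk y -> pr c u w \in allowed c u w.

Lemma card_peers u w : adj u w -> #|peers u w| <= 2.
Proof.
move=> /g_fibre; apply: leq_trans; apply: subset_leq_card.
by apply/subsetP => z; rewrite !inE => /and4P[-> -> ->].
Qed.

Lemma card_peers_degree : #|peers x y| < degree x.
Proof.
have yN : y \in [set w | adj x w] by rewrite inE.
rewrite /degree [ltnRHS](cardsD1 y) yN add1n ltnS; apply: subset_leq_card.
by apply/subsetP => z; rewrite !inE => /and4P[-> _ -> _].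
Qed.

Lemma peers_child : child x y -> #|peers y x| = 0.
Proof.
move=> /andP[y0 /eqP p]; apply/eqP; rewrite cards_eq0 -subset0; apply/subsetP => z.
rewrite inE => /and4P[yz _ _ lt]; have := @par_min y z y0; rewrite adj_sym p => /(_ yz).
by lia.
Qed.

Lemma peers_second : second x y -> #|peers y x| <= 1.
Proof.
move=> /and5P[y0 _ _ xp /forallP h]; rewrite -(cards1 (par y)); apply: subset_leq_card.
apply/subsetP => z; rewrite !inE => /and4P[yz _ _ lt].
by have := h z; rewrite adj_sym yz /=; case: eqP => //= _; lia.
Qed.

Lemma card_free :
  let n := (r + 4 - (#|peers x y| + #|peers y x|)) in
  n * n <= #|setX (free_out c x y) (free_in c x y)|.
Proof.
have bound (A B : {set color}) : #|A| <= #|peers x y| -> #|B| <= #|peers y x| ->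
    r + 4 - (#|peers x y| + #|peers y x|) <= #|~: (A :|: B)|.
  move=> hA hB; have := cardsC (A :|: B); rewrite card_ord.
  by have := (leq_card_setU A B).1; lia.
by rewrite /= cardsX; apply: leq_mul; apply: bound; exact: leq_imset_card.
Qed.

(** At most [r ^ 4 - 1] neighbors of [x] differ from [y], so fewer than [r ^ 2] pairs can occur
    [r ^ 2] times each. *)
Lemma card_ban_full : #|ban_full c x y| < r ^ 2.
Proof.
case: (boolP (child x y)) => xyc; last first.
  suff -> : ban_full c x y = set0 by rewrite cards0 expn_gt0; lia.
  by apply/setP=> p; rewrite !inE (negPf xyc).
pose Q := [set z | child x z && (rk z < rk y)].
have -> : ban_full c x y = [set p | r ^ 2 <= #|[set z in Q | pr c x z == p]|].
  apply/setP=> p; rewrite !inE xyc /=; congr (_ <= #|pred_of_set _|).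
  by apply/setP=> z; rewrite !inE andbA.
have Qlt : #|Q| < r ^ 4.
  apply: leq_trans (degree_le x).
  have yN : y \in [set w | adj x w] by rewrite inE.
  rewrite /degree [leqRHS](cardsD1 y) yN add1n ltnS; apply: subset_leq_card.
  apply/subsetP => z; rewrite !inE => /andP[/child_adj[-> _] lt].
  by rewrite andbT; apply: contraTneq lt => ->; rewrite ltnn.
move: Qlt; rewrite (expnM r 2 2) -[(r ^ 2) ^ 2]mulnn => Qlt.
have := leq_ltn_trans (card_frequent Q (pr c x) (r ^ 2)) Qlt.
by rewrite ltn_mul2r => /andP[].
Qed.

Lemma card_ban_start : #|ban_start c x y| <= 1.
Proof.
apply/card_le1_eqP => p q; rewrite !inE.
move=> /and3P[_ _ /existsP[t /and5P[xt st ty /eqP <- /forallP h]]].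
move=> /and3P[_ _ /existsP[t' /and5P[xt' st' ty' /eqP <- /forallP h']]].
congr (pr c x _); apply: rk_inj.
have := h t'; have := h' t; rewrite xt xt' st st' /=.
by case: (ltngtP (rk t) (rk t')) => //= _; rewrite ?[rk y <= _]leqNgt ?ty ?ty'.
Qed.

(** The last child of [u] with pair [p] escaped [ban_full], so fewer than [r ^ 2] children before it
    carry [p]. As [u] precedes [x], all edges from [u] to its children are already colored. *)
Lemma card_same_pair u p : rk u < rk x ->
  #|[set z | child u z && (pr c u z == p)]| <= r ^ 2.
Proof.
move=> ux; set S := [set z | _].
have [->|[z0 z0S]] := set_0Vmem S; first by rewrite cards0.
have [z zS zmax] := @arg_maxnP _ z0 (fun z => z \in S) rk z0S.
have := zS; rewrite inE => /andP[uz /eqP e]; have [auz ltuz] := child_adj uz.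
have := ok_before auz ltuz (or_introl ux).
rewrite !inE e uz /= !negb_or -ltnNge.
move=> /andP[/andP[/andP[/andP[/andP[/andP[lt _] _] _] _] _] _].
rewrite (cardsD1 z) zS add1n; apply: leq_trans lt; rewrite ltnS subset_leq_card //.
apply/subsetP => w; rewrite !inE => /and3P[wz uw ew]; rewrite uw ew andbT /=.
rewrite ltn_neqAle; apply/andP; split; first by apply: contra wz => /eqP/rk_inj ->.
by apply: zmax; rewrite inE uw.
Qed.

(** A banned pair comes from a sibling of [y] with the same pair at the parent; [card_same_pair]
    also counts [y] itself, whence the strict bound. *)
Lemma card_ban_twin : #|ban_twin c x y| < r ^ 2.
Proof.
case: (boolP (second x y)) => xyc; last first.
  suff -> : ban_twin c x y = set0 by rewrite cards0 expn_gt0; lia.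
  by apply/setP=> p; rewrite !inE (negPf xyc).
have /and5P[y0 _ _ xp _] := xyc.
have plt : rk (par y) < rk x.
  by rewrite ltn_neqAle par_min // andbT; apply: contra xp => /eqP/rk_inj ->.
have := card_same_pair (pr c (par y) y) plt.
set S := [set z | _]; have yS : y \in S by rewrite inE /child y0 !eqxx.
rewrite (cardsD1 y) yS add1n; apply: leq_trans; rewrite ltnS.
apply: leq_trans (leq_imset_card (pr c x) _); apply: subset_leq_card.
apply/subsetP => p; rewrite inE xyc /= => /existsP[z /and5P[zy xz pz ez /eqP <-]].
apply: imset_f; rewrite !inE /child pz ez !andbT; have /andP[-> _] := xz.
by rewrite andbT; apply: contraTneq zy => ->; rewrite ltnn.
Qed.

Lemma card_ban_root : #|ban_root c x y| <= 1.
Proof.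
apply/card_le1_eqP => p q; rewrite !inE => /and3P[_ _ /eqP e] /and3P[_ _ /eqP e'].
have := @mset_add_inj _ (bas c y x) (swap p) (swap q); rewrite e e' => /(_ erefl).
by case: p q {e e'} => [? ?] [? ?] [-> ->].
Qed.

Lemma card_rivals : #|rivals c x| <= r ^ 2.
Proof.
rewrite /rivals; case: ifP => [_|/negbT x0]; first by rewrite cards0.
case: ifP => [_|_]; last by rewrite cards1; lia.
have [_ plt] := parP x0; have := card_same_pair (pr c (par x) x) plt.
set S := [set z | _]; have xS : x \in S by rewrite inE /child x0 !eqxx.
rewrite (cardsD1 x) xS add1n; apply: leq_trans.
apply: leq_trans (leq_card_setU _ _) _; rewrite cards1 add1n ltnS subset_leq_card //.
apply/subsetP => z; rewrite !inE => /and3P[-> zx ->].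
by rewrite !andbT; apply: contraTneq zx => ->; rewrite ltnn.
Qed.

(* A color pair outside [ban_penult] leaves few bad pairs for the next edge: at
   most two ordered pairs complete to a given palette, and (2r-1)^2 > 2r^2. *)
Lemma card_ban_penult : #|ban_penult c x y| <= 2 * r - 2.
Proof.
have := card_many_hits (rivals c x) (pal c) (bas c x y) (2 * r - 1).
have := card_rivals; set n := #|[set p | _]| => h1 h2.
have : #|ban_penult c x y| <= n.
  by apply: subset_leq_card; apply/subsetP => p; rewrite !inE => /andP[].
nia.
Qed.

(** For a non-starter only the root can be a rival. Otherwise the edge to [w], the last neighbor of
    [x] before [y], escaped [ban_penult], which bounds the bad completions by [xy]. *)
Lemma card_ban_last :
  ~~ [forall z, adj x z ==> (rk x < rk z) ==> (z == y)] \/ ~~ starter x ->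
  #|ban_last c x y| <= 2 * r - 2.
Proof.
move=> h; case: (boolP (final x y)) => fin; last first.
  suff -> : ban_last c x y = set0 by rewrite cards0.
  by apply/setP=> p; rewrite !inE (negPf fin).
case: (boolP [forall z, adj x z ==> (rk x < rk z) ==> (z == y)]) h => [_ [//|ns]|nall _].
  apply: (@leq_trans 1); last lia.
  apply: (@leq_trans #|rivals c x|).
    apply: leq_trans (card_hits1 (rivals c x) (pal c) (bas c x y)).
    by apply: subset_leq_card; apply/subsetP => p; rewrite !inE => /andP[].
  by rewrite /rivals (negPf ns); case: ifP; rewrite ?cards0 ?cards1.
have [w0 w0P] : exists w, [&& adj x w, rk x < rk w & w != y].
  by move: nall; rewrite negb_forall => /existsP[w]; rewrite !negb_imply; exists w.
have [w /and3P[xw ltxw wy] wmax] :=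
  @arg_maxnP _ w0 (fun w => [&& adj x w, rk x < rk w & w != y]) rk w0P.
have wlt : rk w < rk y.
  have := forallP fin w; rewrite xw leq_eqVlt => /orP[/eqP/rk_inj e|//].
  by rewrite e eqxx in wy.
have nfin : ~~ final x w.
  by rewrite negb_forall; apply/existsP; exists y; rewrite xy -ltnNge.
have := ok_before xw ltxw (or_intror (conj erefl wlt)).
rewrite /allowed !inE !negb_or nfin /= => /andP[/andP[_ h] _].
have e : bas c x y = mset_add (bas c x w) (pr c x w).
  apply/ffunP=> p; rewrite !ffunE.
  rewrite (cardsD1 w) !inE xw wlt /= addnC eq_sym; congr (_ + _).
  congr #|pred_of_set _|; apply/setP=> z; rewrite !inE.
  case: (boolP (adj x z)) => xz; rewrite ?andbF //=.
  rewrite andbA; congr (_ && _); apply/andP/idP => [[zw zy]|zw].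
    rewrite ltn_neqAle; apply/andP; split; first by apply: contra zw => /eqP/rk_inj ->.
    case: (leqP (rk z) (rk x)) => [le|xz']; first exact: leq_trans le (ltnW ltxw).
    by apply: wmax; rewrite xz xz'; apply: contraTneq zy => ->; rewrite ltnn.
  by split; [apply: contraTneq zw => ->; rewrite ltnn|exact: ltn_trans zw wlt].
move: h; rewrite -ltnNge /ban_last fin /= e; lia.
Qed.

Lemma only_later_bans :
  (forall z, adj x z -> rk x < rk z -> z = y) ->
  [/\ ban_full c x y = set0, ban_start c x y = set0 & ban_twin c x y = set0].
Proof.
move=> only; split; apply/setP=> p; rewrite !inE.
- suff -> : [set z | [&& child x z, rk z < rk y & pr c x z == p]] = set0.
    by rewrite cards0 leqn0 expn_eq0 /= andbT eqn0Ngt (ltnW r_gt1) andbF.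
  apply/setP=> z; rewrite !inE; apply/and3P => -[/child_adj[xz lt] zy _].
  by move: zy; rewrite (only z xz lt) ltnn.
- apply/and3P=> -[_ _ /existsP[z /and5P[/child_adj[xz lt] _ zy _ _]]].
  by move: zy; rewrite (only z xz lt) ltnn.
apply/andP=> -[_ /existsP[z /and5P[zy /second_adj[xz lt] _ _ _]]].
by move: zy; rewrite (only z xz lt) ltnn.
Qed.

Lemma ban_last_or_penult : ban_last c x y = set0 \/ ban_penult c x y = set0.
Proof.
case: (boolP (final x y)) => f; [right|left]; apply/setP=> p;
  by rewrite !inE ?f ?(negPf f).
Qed.

Lemma ban_second_child : child x y -> ban_twin c x y = set0.
Proof.
move=> /andP[_ /eqP yp]; apply/setP=> p; rewrite !inE /second yp eqxx /=.
by rewrite !andbF.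
Qed.

Lemma ban_not_child : ~~ child x y -> ban_full c x y = set0 /\ ban_start c x y = set0.
Proof. by move=> n; split; apply/setP=> p; rewrite !inE (negPf n). Qed.

Lemma ban_not_second : ~~ second x y -> ban_twin c x y = set0.
Proof. by move=> n; apply/setP=> p; rewrite !inE (negPf n). Qed.

Lemma allowed_nonempty : exists p, p \in allowed c x y.
Proof.
apply/card_gt0P; rewrite cardsD subn_gt0.
set S := setX _ _; set F := ban_full _ _ _; set Q := ban_start _ _ _.
set T := ban_twin _ _ _; set R := ban_root _ _ _; set L := ban_last _ _ _.
set N := ban_penult _ _ _.
apply: (@leq_ltn_trans (#|F| + #|Q| + #|T| + #|R| + (#|L| + #|N|))).
  apply: leq_trans (subset_leq_card (subsetIr _ _)) _.
  have h1 := (leq_card_setU (F :|: Q :|: T :|: R :|: L) N).1.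
  have h2 := (leq_card_setU (F :|: Q :|: T :|: R) L).1.
  have h3 := (leq_card_setU (F :|: Q :|: T) R).1.
  have h4 := (leq_card_setU (F :|: Q) T).1.
  have h5 := (leq_card_setU F Q).1.
  lia.
have yx : adj y x by rewrite adj_sym.
have hS := card_free; rewrite /= -/S in hS; apply: leq_trans hS.
have px := card_peers xy; have py := card_peers yx.
have hR := card_ban_root; rewrite -/R in hR.
have rr : r ^ 2 = r * r by rewrite mulnn.
have hN := card_ban_penult; rewrite -/N in hN.
have goal n m : n <= r + 4 - (#|peers x y| + #|peers y x|) -> m < n * n ->
    m < (r + 4 - (#|peers x y| + #|peers y x|)) * (r + 4 - (#|peers x y| + #|peers y x|)).
  by move=> le lt; apply: leq_trans lt _; apply: leq_mul.
(* A starter whose only later neighbor is [y] has degree at most 2, hence at most one peer at [x]: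
   at least [(r + 1) ^ 2] pairs against [r ^ 2 + 1] bans. *)
case: (boolP ([forall z, adj x z ==> (rk x < rk z) ==> (z == y)] && starter x)).
  case/andP=> /forallP h st.
  have only z : adj x z -> rk x < rk z -> z = y.
    by move=> xz lt; have := h z; rewrite xz lt => /eqP.
  have [eF eQ eT] := only_later_bans only.
  have fin : final x y.
    apply/forallP => z; apply/implyP => xz; case: (leqP (rk z) (rk x)); first lia.
    by move=> /(only z xz) ->.
  have eN : N = set0 by apply/setP=> p; rewrite !inE fin.
  have hL : #|L| <= r ^ 2.
    apply: leq_trans card_rivals.
    apply: leq_trans (card_hits1 (rivals c x) (pal c) (bas c x y)).
    by apply: subset_leq_card; apply/subsetP => p; rewrite !inE => /andP[].
  have deg2 : degree x <= 2.
    apply: (@leq_trans #|[set par x; y]|); last by rewrite cards2; case: eqP.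
    apply: subset_leq_card; apply/subsetP => z; rewrite !inE => xz.
    case: (ltngtP (rk z) (rk x)) => [lt|/(only z xz) ->|/rk_inj e].
    - have /andP[_ /forallP/(_ z)] := st.
      by rewrite adj_sym xz lt /= => ->.
    - by rewrite eqxx orbT.
    - by move: xz; rewrite e adj_irrefl.
  have := card_peers_degree => pd.
  rewrite /F /Q /T eF eQ eT eN !cards0; apply: (@goal (r + 1)); first lia.
  by nia.
rewrite negb_and => /orP h.
have hL := card_ban_last h; rewrite -/L in hL.
have hLN : #|L| + #|N| <= 2 * r - 2.
  by case: ban_last_or_penult; rewrite -/L -/N => ->; rewrite cards0; lia.
(* The edge from the parent has no peers at [y]: at least [(r + 2) ^ 2] pairs against
   [r ^ 2 + 2 * r - 1] bans. *)
case: (boolP (child x y)) => ch.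
  rewrite /T ban_second_child // cards0.
  have p0 := peers_child ch; have := card_ban_full; have := card_ban_start.
  rewrite -/F -/Q => hQ hF; apply: (@goal (r + 2)); first lia.
  by nia.
have [eF eQ] := ban_not_child ch; rewrite /F /Q eF eQ !cards0.
(* At most one peer at [y], the parent: at least [(r + 1) ^ 2] pairs against [r ^ 2 + 2 * r - 2]
   bans. *)
case: (boolP (second x y)) => se.
  have p1 := peers_second se; have := card_ban_twin; rewrite -/T => hT.
  by apply: (@goal (r + 1)); [lia|nia].
rewrite /T (ban_not_second se) cards0.
(* Four peers in the worst case: at least [r ^ 2] pairs against [2 * r - 1] bans, enough as
   [r > 1]. *)
by apply: (@goal r); [lia|nia].
Qed.

End Step.

(** Induction along [code], a numerical form of the lexicographic order. The edge of code [m] is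
    recolored in both directions, and [allowed_agree] keeps the earlier edges allowed. *)
Lemma greedy_coloring : exists c, forall x y,
  adj x y -> rk x < rk y -> pr c x y \in allowed c x y.
Proof.
pose N := (\max_(x : G) rk x).+1.
have rkN x : rk x < N by rewrite ltnS; apply: leq_bigmax.
pose code x y := rk x * N + rk y.
have codeP u w x y : code u w < code x y ->
    rk u < rk x \/ rk u = rk x /\ rk w < rk y.
  by rewrite /code => h; have := rkN w; have := rkN y; case: (ltngtP (rk u) (rk x));
     [left|nia|move=> e; right; move: h; rewrite e ltn_add2l].
have code_lt u w x y : rk u < rk x \/ u = x /\ rk w < rk y -> code u w < code x y.
  by rewrite /code => -[lt|[-> lt]]; [have := rkN w; nia|rewrite ltn_add2l].
suff H m : exists c, forall x y, adj x y -> rk x < rk y -> code x y < m ->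
    pr c x y \in allowed c x y.
  have [c hc] := H (N * N); exists c => x y xy lt; apply: hc => //.
  by rewrite /code; have := rkN x; have := rkN y; nia.
elim: m => [|m [c hc]].
  have r4 : 0 < r + 4 by rewrite addnS.
  by exists (fun _ _ => Ordinal r4).
pose next (e : G * G) := [&& adj e.1 e.2, rk e.1 < rk e.2 & code e.1 e.2 == m].
case: (pickP next); last first.
  move=> no; exists c => x y xy lt; rewrite ltnS leq_eqVlt => /orP[e|]; last exact: hc.
  by have := no (x, y); rewrite /next /= xy lt e.
move=> [x y]; rewrite /next {next} => /and3P[/= xy lt /eqP em].
have [|p pa] := @allowed_nonempty c x y xy lt.
  by move=> u w uw ltuw h; apply: hc => //; rewrite -em; apply: code_lt.
pose c' u w := if (u == x) && (w == y) then p.1 else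
               if (u == y) && (w == x) then p.2 else c u w.
have xny : (x == y) = false by apply/eqP => e; rewrite e ltnn in lt.
have ynx : (y == x) = false by rewrite eq_sym.
have prc' : pr c' x y = p.
  by rewrite /pr /c' !eqxx ?xny ?ynx /=; case: (p).
have agree u w a b : (~~ before u w x y) -> before u w a b -> c a b = c' a b.
  move=> nb b1; rewrite /c'; case: andP => [[/eqP ea /eqP eb]|_].
    by rewrite -ea -eb b1 in nb.
  by case: andP => // -[/eqP ea /eqP eb]; rewrite -ea -eb beforeC b1 in nb.
exists c' => u w uw ltuw; rewrite ltnS leq_eqVlt => /orP[/eqP e|clt].
  have [eu ew] : u = x /\ w = y.
    rewrite -em in e; have lt1 := @codeP u w x y; have lt2 := @codeP x y u w.
    have : rk u = rk x /\ rk w = rk y.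
      have := rkN w; have := rkN y; move: e; rewrite /code => *.
      have : rk u = rk x by nia.
      by nia.
    by case=> /rk_inj-> /rk_inj->.
  subst u w; rewrite prc' -(@allowed_agree c c' x y xy) // => a b _.
  by apply: agree; rewrite /before ynx !ltnn andbF !orbF /= -leqNgt ltnW.
have nb : ~~ before u w x y.
  apply/negP=> b; rewrite -em in clt; have := codeP _ _ _ _ clt.
  case/or4P: b => [| |/andP[/eqP/(congr1 rk) e]|/andP[/eqP/(congr1 rk) e]]; lia.
have <- : pr c u w = pr c' u w.
  have ne : ((u == x) && (w == y) = false) /\ ((u == y) && (w == x) = false).
    split; apply/negP => /andP[/eqP e1 /eqP e2]; subst u w; first by lia.
    by lia.
  rewrite /pr /c' ne.1 ne.2 [(w == x) && _]andbC [(w == y) && _]andbC.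
  by rewrite ne.1 ne.2.
rewrite -(@allowed_agree c c' u w uw); first exact: hc.
by move=> a b _; apply: agree.
Qed.

Hypothesis par_mono : forall y z, y != v0 -> z != v0 -> rk y <= rk z ->
  rk (par y) <= rk (par z).
Hypothesis starter_closed : forall t x z, starter t -> x != v0 -> par x = par t ->
  rk t <= rk x -> adj z x -> rk z < rk t -> z = par t.

(** * Automorphisms preserving the coloring *)

Section Colored.
Variable c : G -> G -> color.
Hypothesis ok : forall x y, adj x y -> rk x < rk y -> pr c x y \in allowed c x y.

(** The earlier of [y] and [z] is a peer of the later one at [u]. *)
Lemma proper_groups u y z : adj u y -> adj u z -> z != y -> g u z = g u y ->
  c u z != c u y /\ c z u != c y u.
Proof.
wlog lt : y z / rk z < rk y => [H|].
  move=> uy uz zy e; case: (ltngtP (rk z) (rk y)) => [lt|lt|/rk_inj e']; first exact: H.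
    by rewrite eq_sym [c z u == _]eq_sym; apply: H; rewrite // eq_sym.
  by rewrite e' eqxx in zy.
move=> uy uz zy e; have yu : adj y u by rewrite adj_sym.
have zp : z \in peers u y by rewrite inE uz e zy lt eqxx.
case: (ltngtP (rk u) (rk y)) => [h|h|/rk_inj e']; last by rewrite e' adj_irrefl in uy.
  have := ok uy h; rewrite inE => /andP[_]; rewrite in_setX !in_setC !in_setU !negb_or.
  case/andP=> /andP[h1 _] /andP[h2 _]; split.
    by apply: contra h1 => /eqP <-; apply: imset_f.
  by apply: contra h2 => /eqP <-; apply: (imset_f (c^~ u)).
have := ok yu h; rewrite inE => /andP[_]; rewrite in_setX !in_setC !in_setU !negb_or.
case/andP=> /andP[_ h1] /andP[_ h2]; split.
  by apply: contra h2 => /eqP <-; apply: imset_f.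
by apply: contra h1 => /eqP <-; apply: (imset_f (c^~ u)).
Qed.

Lemma pal_final x y : adj x y -> final x y ->
  pal c x = mset_add (bas c x y) (pr c x y).
Proof.
move=> xy /forallP fin; apply/ffunP=> p; rewrite !ffunE.
rewrite (cardsD1 y) !inE xy /= addnC eq_sym; congr (_ + _).
congr #|pred_of_set _|; apply/setP=> z; rewrite !inE.
case: (boolP (adj x z)) => xz; rewrite ?andbF //=; congr (_ && _).
have := fin z; rewrite xz leq_eqVlt /= => /orP[/eqP/rk_inj ->|lt].
  by rewrite eqxx ltnn.
by rewrite lt; apply: contraTneq lt => ->; rewrite ltnn.
Qed.

Lemma final_exists u : exists2 z, adj u z & final u z.
Proof.
have : 0 < degree u by have := degree_gt1 u; lia.
case/card_gt0P => w; rewrite inE => uw.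
have [z uz zmax] := @arg_maxnP _ w (fun w => adj u w) rk uw.
by exists z => //; apply/forallP => a; apply/implyP; apply: zmax.
Qed.

Lemma other_neighbor u z : exists2 w, adj u w & w != z.
Proof.
have := degree_gt1 u; rewrite /degree (cardsD1 z) => h.
have : 0 < #|[set w | adj u w] :\ z| by lia.
by case/card_gt0P => w; rewrite !inE => /andP[wz uw]; exists w.
Qed.

Lemma allowedE x y p : p \in allowed c x y -> [/\ p \notin ban_full c x y,
  p \notin ban_start c x y, p \notin ban_twin c x y, p \notin ban_root c x y
  & p \notin ban_last c x y].
Proof.
by rewrite in_setD !in_setU !negb_or => /andP[/andP[/andP[/andP[/andP[/andP[]]]]]].
Qed.

Lemma pal_last u z f : adj u z -> rk u < rk z -> final u z -> f \in rivals c u ->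
  pal c u != pal c f.
Proof.
move=> uz lt fin fr; have [_ _ _ _] := allowedE (ok uz lt).
rewrite inE fin /= negb_exists => /forallP/(_ f).
by rewrite fr (pal_final uz fin).
Qed.

(** The palette of [u] is completed by the edge to its last neighbor. If that neighbor is later than
    [u], then [ban_last] applies, the root being a rival; otherwise [ban_root] does. *)
Lemma pal_root u : u != v0 -> pal c u != pal c v0.
Proof.
move=> u0; have [z uz fin] := final_exists u.
case: (ltngtP (rk u) (rk z)) => [lt|lt|/rk_inj e]; last by rewrite e adj_irrefl in uz.
  apply: pal_last fin _ => //; rewrite /rivals (negPf u0).
  by case: ifP; rewrite !inE eqxx.
have zu : adj z u by rewrite adj_sym.
have [_ _ _ + _] := allowedE (ok zu lt); rewrite inE fin.
(* [ban_root] ignores edges at the root; were [z] the root, a second neighbor of [u] would have to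
   precede it. *)
have -> : z != v0.
  have [w uw wz] := other_neighbor u z; apply: contraNneq wz => z0.
  have := forallP fin w; rewrite uw z0 /= => le.
  by apply/negPn/negP => /root_first; rewrite ltnNge le.
by rewrite /= (pal_final uz fin).
Qed.

(** A starter has only its parent before it and degree at least 2, so its last edge leads to a later
    vertex and [ban_last] applies. *)
Lemma pal_starter t x : starter t -> child (par t) x -> rk x < rk t ->
  pr c (par t) x = pr c (par t) t -> pal c t != pal c x.
Proof.
move=> st ch lt e; have /andP[t0 /forallP h] := st.
have [z tz fin] := final_exists t.
apply: (pal_last tz) => //; last first.
  by rewrite /rivals (negPf t0) st !inE ch lt e eqxx orbT.
case: (ltngtP (rk t) (rk z)) => [//|lt'|/rk_inj e']; last by rewrite e' adj_irrefl in tz.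
have [w tw wz] := other_neighbor t (par t).
have := h w; rewrite adj_sym tw (negPf wz) implybF /= => wt.
by have := forallP fin w; rewrite tw /=; lia.
Qed.

Lemma second_exists y : y != v0 -> ~~ starter y -> exists z, second z y.
Proof.
move=> y0 /(nonstarter_neighbor y0)[w /and3P[wy lt wp]].
have w_ok : adj w y && (w != par y) by rewrite wy.
have [z /andP[zy zp] zmin] := @arg_minnP _ w (fun w => adj w y && (w != par y)) rk w_ok.
exists z; apply/and5P; split=> //; first exact: leq_ltn_trans (zmin w w_ok) lt.
by apply/forallP => a; apply/implyP => ay; apply/implyP => ap; rewrite zmin ?ay.
Qed.

Section FixBelow.
Variables (psi : {perm G}) (y : G).
Hypothesis psi_adj : forall u w, adj (psi u) (psi w) = adj u w.
Hypothesis psi_fix : forall z, rk z < rk y -> psi z = z.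

Lemma above_perm a : rk y <= rk a -> rk y <= rk (psi a).
Proof.
move=> ya; rewrite leqNgt; apply/negP => lt.
by have /perm_inj e := psi_fix lt; rewrite e ltnNge ya in lt.
Qed.

(** A vertex below [y] is fixed, so it is adjacent to [a] exactly when it is adjacent to [psi a];
    hence both have the same first neighbor. A general [psi] serves for [phi] and its inverse
    alike. *)
Lemma child_perm v a : rk v < rk y -> rk y <= rk a -> child v a -> child v (psi a).
Proof.
move=> vy ya va; have [adj_va _] := child_adj va; have /andP[a0 /eqP pa] := va.
have y' := above_perm ya.
have psi0 : psi a != v0.
  apply: contraTneq vy => e; rewrite e in y'; rewrite -leqNgt (leq_trans y') //.
  by case: (eqVneq v v0) => [->//|/root_first/ltnW].
rewrite /child psi0 /=; apply/eqP/rk_inj/eqP; rewrite eqn_leq par_min //=; last first.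
  by rewrite -(psi_fix vy) psi_adj.
rewrite leqNgt; apply/negP => lt.
have lty := ltn_trans lt vy; have [w_adj _] := parP psi0.
by move: w_adj; rewrite -{1}(psi_fix lty) psi_adj => /(par_min a0); rewrite pa leqNgt lt.
Qed.

End FixBelow.

Section Fix.
Variable phi : {perm G}.
Hypothesis phi_adj : forall u w, adj (phi u) (phi w) = adj u w.
Hypothesis phi_col : forall u w, adj u w -> c (phi u) (phi w) = c u w.

Lemma pr_perm u w : adj u w -> pr c (phi u) (phi w) = pr c u w.
Proof. by move=> uw; rewrite /pr !phi_col // adj_sym. Qed.

Lemma pal_perm u : pal c (phi u) = pal c u.
Proof.
apply/ffunP=> p; rewrite !ffunE -[RHS](card_imset _ (@perm_inj _ phi)).
congr #|pred_of_set _|; apply/setP=> z; rewrite inE.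
apply/idP/imsetP => [/andP[uz e]|[w + ->]]; last first.
  by rewrite inE phi_adj => /andP[uw /eqP <-]; rewrite uw pr_perm // eqxx.
exists (phi^-1 z)%g; last by rewrite permKV.
have uz' : adj u (phi^-1 z)%g by rewrite -phi_adj permKV.
by rewrite inE uz' -pr_perm // permKV.
Qed.

Section Starter.
Variable y : G.
Hypotheses (y0 : y != v0) (fix_y : forall z, rk z < rk y -> phi z = z).

Lemma phi_inv_fix z : rk z < rk y -> (phi^-1)%g z = z.
Proof. by move=> lt; rewrite -{1}(fix_y lt) permK. Qed.

Lemma phi_inv_adj u w : adj (phi^-1 u)%g (phi^-1 w)%g = adj u w.
Proof. by rewrite -phi_adj !permKV. Qed.

Lemma par_lt : rk (par y) < rk y. Proof. by case: (parP y0). Qed.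

(** If [y] moves, its image comes later with the same parent, the same second neighbor and the same
    pairs on both edges, which [ban_twin] forbids. *)
Lemma fix_nonstarter : ~~ starter y -> phi y = y.
Proof.
move=> ns; have [z sz] := second_exists y0 ns.
have /and5P[_ zy zlt zp /forallP zmin] := sz.
have cy : child (par y) y by rewrite /child y0 eqxx.
have cy' := child_perm phi_adj fix_y par_lt (leqnn _) cy.
have le := above_perm fix_y (leqnn _).
apply/eqP/negPn/negP => ne.
have lt : rk y < rk (phi y).
  by rewrite ltn_neqAle le andbT; apply: contra ne => /eqP/rk_inj <-.
have /andP[y0' /eqP p'] := cy'.
have zy' : adj z (phi y) by rewrite -(fix_y zlt) phi_adj.
have sz' : second z (phi y).
  rewrite /second y0' zy' (ltn_trans zlt lt) p' zp /=.
  apply/forallP => w; apply/implyP => wy'; apply/implyP => wp.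
  rewrite leqNgt; apply/negP => wz; have wy := ltn_trans wz zlt.
  have := zmin w; rewrite -(phi_adj w) (fix_y wy) wy' wp /=.
  by rewrite leqNgt wz.
have [_ _ + _ _] := allowedE (ok zy' (ltn_trans zlt lt)).
rewrite inE sz' negb_exists => /forallP/(_ y); rewrite lt sz p' eqxx /=.
have [pa _] := parP y0.
rewrite -(pr_perm pa) -(pr_perm zy) (fix_y par_lt) (fix_y zlt).
by rewrite !eqxx.
Qed.

(* [t] is the last starter up to [x] among the children of [par y], so [x] is
   joined to [t] by a path of such children, each vertex being the second neighbor
   of the previous one.  Its preimage stays among the children before
   [t], since no child from [t] on is adjacent to one of them. *)
Lemma pull_back t x : starter t -> child (par y) t -> rk y < rk t ->
  child (par y) x -> rk t <= rk x ->
  (forall s, child (par y) s -> starter s -> rk s <= rk x -> rk s <= rk t) ->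
  rk ((phi^-1)%g x) < rk t -> rk ((phi^-1)%g t) < rk t.
Proof.
move=> st ct yt.
move: {2}(rk x) (leqnn (rk x)) => n; elim: n x => [|n IH] x xn cx tx tmax lt.
  by have := leq_trans yt (leq_trans tx xn).
case: (eqVneq x t) => [e|xt]; first by rewrite -{1}e.
have /andP[x0 /eqP px] := cx; have /andP[t0 /eqP pt] := ct.
have nsx : ~~ starter x.
  apply: contra xt => sx; apply/eqP/rk_inj/eqP; rewrite eqn_leq tx andbT.
  exact: tmax.
have [z /and5P[_ zx zlt zp _]] := second_exists x0 nsx; rewrite px in zp.
have tz : rk t <= rk z.
  rewrite leqNgt; apply: contra zp => zt; apply/eqP; rewrite -pt.
  by apply: (starter_closed st x0 _ tx zx zt); rewrite px pt.
have z0 : z != v0.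
  by apply: contraTneq tz => ->; rewrite -ltnNge; apply: root_first.
have cz : child (par y) z.
  have le1 := par_mono z0 x0 (ltnW zlt); have le2 := par_mono t0 z0 tz.
  rewrite px in le1; rewrite pt in le2.
  by rewrite /child z0; apply/eqP/rk_inj/eqP; rewrite eqn_leq le1.
have iz := child_perm phi_inv_adj phi_inv_fix par_lt (ltnW (leq_trans yt tz)) cz.
apply: (IH z) => //; first by rewrite -ltnS (leq_trans zlt).
  by move=> s cs ss sz; apply: tmax => //; apply: leq_trans sz (ltnW zlt).
rewrite ltnNge; apply/negP => tz'.
have /andP[z0' /eqP pz'] := iz.
have e : (phi^-1)%g x = par t.
  by apply: (starter_closed st z0' _ tz' _ lt); rewrite ?phi_inv_adj 1?adj_sym // pz' pt.
have := child_adj cx; rewrite -(permKV phi x) e pt (fix_y par_lt) //.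
by rewrite ltnn => -[].
Qed.

(** If [y] moves, let [t] be the last starter among its siblings up to [phi y]. If [t] is [y], the
    pair of [phi y] at the parent violates [ban_start]. Otherwise [pull_back] puts the preimage of
    [t] before [t], with the same pair and palette, against [pal_starter]. *)
Lemma fix_starter : starter y -> phi y = y.
Proof.
move=> sy.
have cy : child (par y) y by rewrite /child y0 eqxx.
have cy' := child_perm phi_adj fix_y par_lt (leqnn _) cy.
have le := above_perm fix_y (leqnn _).
apply/eqP/negPn/negP => ne.
have lt : rk y < rk (phi y).
  by rewrite ltn_neqAle le andbT; apply: contra ne => /eqP/rk_inj <-.
pose Q t := [&& child (par y) t, starter t & rk t <= rk (phi y)].
have Qy : Q y by rewrite /Q cy sy.
have [t Qt tmax] := @arg_maxnP _ y Q rk Qy; have /and3P[ct st tle] := Qt.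
have [adj_py _] := parP y0; have [adj_py' _] := child_adj cy'.
have pe : pr c (par y) (phi y) = pr c (par y) y by rewrite -(pr_perm adj_py) (fix_y par_lt).
have yt : rk y <= rk t := tmax y Qy; case: (eqVneq t y) => [ty|ty].
  have [_ + _ _ _] := allowedE (ok adj_py' (ltn_trans par_lt lt)).
  rewrite inE cy' /=.
  have -> /= : ~~ starter (phi y).
    apply/negP => s'; have := tmax (phi y); rewrite /Q cy' s' leqnn ty.
    by move=> /(_ isT) h; have := leq_ltn_trans h lt; rewrite ltnn.
  rewrite negb_exists => /forallP/(_ y); rewrite cy sy lt pe eqxx /=.
  rewrite negb_forall => /existsP[s]; rewrite !negb_imply => /and4P[cs ss ys].
  rewrite -ltnNge => sy'; have := tmax s; rewrite /Q cs ss ltnW // => /(_ isT) h.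
  by rewrite ty in h; have := leq_ltn_trans h ys; rewrite ltnn.
have {}yt : rk y < rk t.
  by rewrite ltn_neqAle yt andbT; apply: contra ty => /eqP/rk_inj ->.
have back : rk ((phi^-1)%g t) < rk t.
  apply: (@pull_back t (phi y)) => //; last by rewrite permK.
  by move=> s cs ss sl; apply: tmax; rewrite /Q cs ss.
have cb := child_perm phi_inv_adj phi_inv_fix par_lt (ltnW yt) ct.
have /andP[_ /eqP pt] := ct; have [adj_b _] := child_adj cb.
have := @pal_starter t ((phi^-1)%g t) st; rewrite pt => /(_ cb back).
rewrite -(pr_perm adj_b) permKV (fix_y par_lt) // => /(_ erefl).
by rewrite -(pal_perm ((phi^-1)%g t)) permKV eqxx.
Qed.

End Starter.

(** Strong induction on the rank, starting from the root, whose palette is unique. *)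
Lemma perm_fixes y : phi y = y.
Proof.
move: {2}(rk y) (erefl (rk y)) => n; elim/ltn_ind: n y => n IH y en.
case: (eqVneq y v0) => [->|y0].
  apply/eqP/negPn/negP => /pal_root; by rewrite pal_perm eqxx.
have fix_y z : rk z < rk y -> phi z = z by rewrite en => /IH; apply.
by case: (boolP (starter y)) => sy; [apply: fix_starter|apply: fix_nonstarter].
Qed.

End Fix.
End Colored.
End Greedy.

(** * Arc colorings of the symmetric digraph *)

Lemma min_degree_le (G : sgraph) (u : G) : min_degree G <= degree u.
Proof.
rewrite /min_degree; have: u \in index_enum G by rewrite mem_index_enum.
elim: (index_enum G) => //= v s IH; rewrite big_cons inE => /predU1P[->|/IH le].
  exact: geq_minl.
exact: leq_trans (geq_minr _ _) le.
Qed.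

Section Arcs.
Variables (G : sgraph) (k : nat) (c : G -> G -> 'I_k).
Notation D := (sym_digraph G).

Definition arc_coloring (a : Defs.arc D) : 'I_k := c (Defs.tail a) (Defs.head a).

Lemma arc_eq (a b : Defs.arc D) :
  Defs.tail a = Defs.tail b -> Defs.head a = Defs.head b -> a = b.
Proof.
by case: a b => [[a1 a2] a_arc] [[b1 b2] b_arc] /= e1 e2; apply: val_inj => /=; congr pair.
Qed.

Lemma arc_adj (a : Defs.arc D) : @adj G (Defs.tail a) (Defs.head a).
Proof. exact: (valP a). Qed.

Lemma arc_exists (u w : G) : adj u w ->
  exists a : Defs.arc D, Defs.tail a = u /\ Defs.head a = w.
Proof.
move=> uw; have uw' : is_arc ((u, w) : D * D).1 ((u, w) : D * D).2 by [].
by exists (Sub ((u, w) : D * D) uw').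
Qed.

Lemma card_arcs_to (u : G) (P : pred G) :
  #|[set a : Defs.arc D | (Defs.head a == u) && P (Defs.tail a)]|
    = #|[set z | adj u z && P z]|.
Proof.
rewrite -(card_in_imset (f := @Defs.tail D)); last first.
  move=> a b; rewrite !inE => /andP[/eqP e _] /andP[/eqP e' _] e1.
  by apply: arc_eq => //; rewrite e e'.
congr #|pred_of_set _|; apply/setP=> z; rewrite inE; apply/imsetP/andP.
  case=> a + ->; rewrite inE => /andP[/eqP <- Pa]; split=> //.
  by rewrite adj_sym arc_adj.
case=> uz Pz; have [|a [ta ha]] := @arc_exists z u; first by rewrite adj_sym.
by exists a => //; rewrite inE ta ha eqxx.
Qed.

Lemma card_arcs_from (u : G) (P : pred G) :
  #|[set a : Defs.arc D | (Defs.tail a == u) && P (Defs.head a)]|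
    = #|[set z | adj u z && P z]|.
Proof.
rewrite -(card_in_imset (f := @Defs.head D)); last first.
  move=> a b; rewrite !inE => /andP[/eqP e _] /andP[/eqP e' _] e1.
  by apply: arc_eq => //; rewrite e e'.
congr #|pred_of_set _|; apply/setP=> z; rewrite inE; apply/imsetP/andP.
  case=> a + ->; rewrite inE => /andP[/eqP <- Pa]; split=> //.
  by rewrite arc_adj.
case=> uz Pz; have [a [ta ha]] := arc_exists uz.
by exists a => //; rewrite inE ta ha eqxx.
Qed.

Lemma degreeT (u : G) : #|[set z | adj u z && xpredT z]| = degree u.
Proof. by congr #|pred_of_set _|; apply/setP=> z; rewrite !inE andbT. Qed.

Variable g : G -> G -> nat.
Hypothesis g_lt : forall u z, adj u z -> g u z < (degree u)./2.
Hypothesis g_proper : forall u y z, adj u y -> adj u z -> z != y -> g u z = g u y ->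
  c u z != c u y /\ c z u != c y u.

(** Vertices satisfying [P] lie in distinct groups, and there are at most [(degree u)./2] groups. *)
Lemma card_color_class (u : G) (P : pred G) :
  (forall y z, adj u y -> adj u z -> g u z = g u y -> P y -> P z -> z = y) ->
  2 * #|[set z | adj u z && P z]| <= degree u.
Proof.
move=> inj; suff : #|[set z | adj u z && P z]| <= (degree u)./2 by lia.
set S := [set z | _]; pose h z := inord (g u z) : 'I_(degree u)./2.-1.+1.
have [->|[z0]] := set_0Vmem S; first by rewrite cards0.
rewrite inE => /andP[uz0 _].
have pos : 0 < (degree u)./2 by apply: leq_ltn_trans (g_lt uz0).
rewrite -(card_in_imset (f := h)) => [|y z].
  by apply: leq_trans (max_card _) _; rewrite card_ord prednK.
rewrite !inE => /andP[uy Py] /andP[uz Pz] /(congr1 val).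
rewrite /h /= !inordK ?prednK ?g_lt // => e.
exact: inj.
Qed.

Lemma arc_coloring_majority : majority arc_coloring.
Proof.
move=> u alpha; split.
  have -> : [set a : Defs.arc D | (Defs.head a == u) && (arc_coloring a == alpha)] =
      [set a : Defs.arc D | (Defs.head a == u) && (c (Defs.tail a) u == alpha)].
    by apply/setP=> a; rewrite !inE; apply: andb_id2l => /eqP <-.
  have -> : [set a : Defs.arc D | Defs.head a == u] =
      [set a : Defs.arc D | (Defs.head a == u) && xpredT (Defs.tail a)].
    by apply/setP=> a; rewrite !inE andbT.
  rewrite (card_arcs_to u (fun z => c z u == alpha)) (card_arcs_to u xpredT).
  rewrite degreeT.
  apply: card_color_class => y z uy uz e /eqP ey /eqP ez.
  apply/eqP/negPn/negP => ne; have [_] := g_proper uy uz ne e.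
  by rewrite ey ez eqxx.
have -> : [set a : Defs.arc D | (Defs.tail a == u) && (arc_coloring a == alpha)] =
    [set a : Defs.arc D | (Defs.tail a == u) && (c u (Defs.head a) == alpha)].
  by apply/setP=> a; rewrite !inE; apply: andb_id2l => /eqP <-.
have -> : [set a : Defs.arc D | Defs.tail a == u] =
    [set a : Defs.arc D | (Defs.tail a == u) && xpredT (Defs.head a)].
  by apply/setP=> a; rewrite !inE andbT.
rewrite (card_arcs_from u (fun z => c u z == alpha)) (card_arcs_from u xpredT).
rewrite degreeT.
apply: card_color_class => y z uy uz e /eqP ey /eqP ez.
apply/eqP/negPn/negP => ne; have [+ _] := g_proper uy uz ne e.
by rewrite ey ez eqxx.
Qed.

Lemma arc_coloring_distinguishing :
  (forall phi : {perm G}, (forall u w, adj (phi u) (phi w) = adj u w) ->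
    (forall u w, adj u w -> c (phi u) (phi w) = c u w) -> forall y, phi y = y) ->
  distinguishing arc_coloring.
Proof.
move=> rigid phi aut pres; apply/permP => y; rewrite perm1; apply: rigid => // u w uw.
have [a [ta ha]] := arc_exists uw.
have [|b [tb hb]] := @arc_exists (phi u) (phi w).
  by rewrite -[adj _ _]/(is_arc _ _) aut.
have := pres a b; rewrite /arc_coloring ta ha tb hb; exact.
Qed.

End Arcs.

Lemma sym_digraph_coloring (G : sgraph) (r : nat) :
  connected_graph G -> 2 <= min_degree G -> 1 < r -> max_degree G <= r ^ 4 ->
  majority_distinguishable (sym_digraph G) (r + 4).
Proof.
move=> [/card_gt0P[v0 _] conn] deg2 r1 degr.
have [rk [par [rk_inj parP par_min par_mono closed]]] := search_order v0 conn.
have deg_gt1 (u : G) : 1 < degree u := leq_trans deg2 (min_degree_le u).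
have deg_le (u : G) : degree u <= r ^ 4.
  by apply: leq_trans degr; apply: (leq_bigmax u).
have [g gP] := fin_all_exists (fun u : G => small_groups [set w | adj u w]).
have g_lt (u z : G) : adj u z -> g u z < (degree u)./2.
  by move=> uz; have [h _] := gP u; apply: h; rewrite ?inE //; apply: deg_gt1.
have g_fibre (u y : G) : adj u y ->
    #|[set z | adj u z && ((g u z == g u y) && (z != y))]| <= 2.
  move=> uy; have [_ h] := gP u; have := h y; rewrite inE => /(_ uy).
  by apply: leq_trans; apply: subset_leq_card; apply/subsetP => z; rewrite !inE.
have [c ok] := greedy_coloring rk_inj parP par_min g_fibre r1 deg_le.
exists (arc_coloring c); split.
  apply: (@arc_coloring_majority _ _ c g g_lt) => u y z.
  exact: (proper_groups rk_inj ok).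
apply: arc_coloring_distinguishing => phi phi_adj phi_col.
exact: (perm_fixes rk_inj parP par_min r1 deg_gt1 par_mono closed ok phi_adj phi_col).
Qed.

(** * The least number of colors and the fourth root *)

Lemma least_nat (P : nat -> Prop) n : P n -> exists m, P m /\ forall k, P k -> m <= k.
Proof.
elim/ltn_ind: n => n IH Pn.
(* [P] need not be decidable, hence excluded middle. *)
case: (classic (exists k, k < n /\ P k)) => [[k [lt Pk]]|no]; first exact: IH lt Pk.
exists n; split=> // k Pk; rewrite leqNgt; apply/negP => lt.
by apply: no; exists k.
Qed.

Import Order.TTheory GRing.Theory Num.Theory.

Lemma ceil_fourth_root_nat (n : nat) :
  exists r : nat, ceil_fourth_root n = (r%:Z)%R /\ n <= r ^ 4.
Proof.
rewrite /ceil_fourth_root; set x : algC := (4.-root _)%R.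
have x0 : (0 <= x)%R by rewrite rootC_ge0 ?ler0n.
have xle : (x <= (Num.ceil x)%:~R)%R by rewrite real_ceil_ge ?ger0_real.
have : (0 <= Num.ceil x)%R by rewrite -(ler0z algC) (le_trans x0 xle).
case e : (Num.ceil x) xle => [r|//] xle _; exists r; split=> //.
rewrite -(ler_nat algC) natrX -(rootCK (n := 4) isT n%:R%R) -/x.
by rewrite lerXn2r ?nnegrE ?ler0n.
Qed.

Theorem theorem26 (G : sgraph) :
  connected_graph G -> 2 <= min_degree G ->
  exists m : nat, is_majority_dist_index (sym_digraph G) m /\
    (m%:Z <= ceil_fourth_root (max_degree G) + 4)%R.
Proof.
move=> conn deg2; have [r [-> le]] := ceil_fourth_root_nat (max_degree G).
have [/card_gt0P[u _] _] := conn.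
have max2 : 2 <= max_degree G.
  by apply: leq_trans deg2 _; apply: leq_trans (min_degree_le u) _; apply: (leq_bigmax u).
(* [r <= 1] would bound the maximum degree by 1. *)
have r1 : 1 < r by case: r le => [|[|//]]; rewrite ?exp0n ?exp1n //; lia.
have col := sym_digraph_coloring conn deg2 r1 le.
have [m [mP min]] := least_nat col; exists m; split; first by split.
by have := min _ col; lia.
Qed.
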